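(* Let $K\subset\mathbb{R}^n$ be an isotone projection cone generated by linearly independent vectors $b_1,\ldots,b_n$, and let $\bar x\in\mathbb{R}^n$. Then the metric projection $P_K:\mathbb{R}^n\to K$ has the following differentiability properties. (i) If $I^\bullet_{\bar x}=\emptyset$, then $P_K$ is strictly Fréchet differentiable at $\bar x$, and $$\nabla P_K(\bar x)(y)=B(B^TB)^{-1}B^Ty\qquad\text{for all }y\in\mathbb{R}^n,$$ where $B$ is the matrix whose columns are the vectors $b_i$, $i\in I^+_{\bar x}$. (ii) If $I^\bullet_{\bar x}\ne\emptyset$, then $P_K$ is not Fréchet differentiable at $\bar x$, but it is directionally differentiable at $\bar x$ in every direction $h\in\mathbb{R}^n$. Moreover, for any $h\in\mathbb{R}^n$ there are two disjoint subsets $A_h^\bullet$ and $B_h^\bullet$ of $I^\bullet_{\bar x}$ such that $$h=\sum_{i\in I^+_{\bar x}}\alpha_i b_i+\sum_{i\in A_h^\bullet}\alpha_i b_i+\sum_{j\in B_h^\bullet}\beta_j u_j+\sum_{j\in I^-_{\bar x}}\beta_j u_j,$$ where $\alpha_i>0$ for all $i\in A_h^\bullet$ and $\beta_j>0$ for all $j\in B_h^\bullet$, and then the directional derivative of $P_K$ at $\bar x$ in the direction $h$ is $$P_K'(\bar x;h)=B(B^TB)^{-1}B^Th,$$ where $B$ is the matrix whose columns are the vectors $b_i$, $i\in I^+_{\bar x}\cup A_h^\bullet$.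
   Context: $N=\{1,\ldots,n\}$ with $n\ge1$. For linearly independent $b_1,\ldots,b_n\in\mathbb{R}^n$, the cone generated by them is $K=\{\sum_{i=1}^n\alpha_i b_i\mid \alpha_i\ge 0\}$; the associated vectors $u_1,\ldots,u_n$ are determined by $\langle u_j,b_i\rangle=-\delta_{ij}$ (Kronecker delta). $P_K$ denotes the Euclidean metric projection onto $K$. $K$ is an isotone projection cone if for all $x,y$ with $y-x\in K$ one has $P_K(y)-P_K(x)\in K$; it is known that this is equivalent to $\langle u_j,u_k\rangle\le 0$ for all $j\neq k$. Index sets: it is known that for every $x\in\mathbb{R}^n$ there is a unique subset $I\subset N$ such that $x=\sum_{i\in N\setminus I}\alpha_i b_i+\sum_{j\in I}\beta_j u_j$ with $\beta_j>0$ for all $j\in I$ and $\alpha_i\ge0$ for all $i\in N\setminus I$ (the coefficients are then unique, and $P_K(x)=\sum_{i\in N\setminus I}\alpha_i b_i$). With this $I$, define $I_x^+:=\{i\in N\setminus I\mid\alpha_i>0\}$, $I_x^\bullet:=\{i\in N\setminus I\mid\alpha_i=0\}$, $I_x^-:=I$. Differentiability: $f'(x;h):=\lim_{t\downarrow0}(f(x+th)-f(x))/t$ is the directional derivative. $f$ is strictly Fréchet differentiable at $\bar x$ with derivative $\nabla f(\bar x)$ (a linear map) if $\lim_{(u,v)\to(\bar x,\bar x)}\frac{f(u)-f(v)-\nabla f(\bar x)(u-v)}{\|u-v\|}=0$ (with $u\neq v$). If the index set of the columns of $B$ is empty, $B(B^TB)^{-1}B^T$ is understood as the zero map. *)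

(* Defs.v *)
From HB Require Import structures.
From mathcomp Require Import all_boot all_order all_algebra.
From mathcomp Require Import all_classical all_reals all_analysis.

Set Implicit Arguments.
Unset Strict Implicit.
Unset Printing Implicit Defensive.

Import Order.TTheory GRing.Theory Num.Theory.
Import numFieldNormedType.Exports.

Local Open Scope classical_set_scope.
Local Open Scope ring_scope.

(* The library norm on 'cV[R]_n is the sup norm; the metric projection needs
   the Euclidean one, which induces the same topology. *)
Definition dotv (R : realType) (n : nat) (x y : 'cV[R]_n) : R :=
  \sum_(i < n) x i 0 * y i 0.

Definition enorm (R : realType) (n : nat) (x : 'cV[R]_n) : R :=
  Num.sqrt (dotv x x).

Definition cone (R : realType) (n : nat) (b : 'I_n -> 'cV[R]_n) :
    set 'cV[R]_n :=
  [set x | exists alpha : 'I_n -> R,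
     (forall i, 0 <= alpha i) /\ x = \sum_(i < n) alpha i *: b i].

(* 0 is a junk value, for when no nearest point exists. *)
Definition metric_proj (R : realType) (n : nat) (K : set 'cV[R]_n)
    (x : 'cV[R]_n) : 'cV[R]_n :=
  xget 0 [set p | K p /\ forall z, K z -> enorm (x - p) <= enorm (x - z)].

Definition isotone_proj (R : realType) (n : nat) (K : set 'cV[R]_n) : Prop :=
  forall x y, K (y - x) -> K (metric_proj K y - metric_proj K x).

Definition assoc_vectors (R : realType) (n : nat) (b u : 'I_n -> 'cV[R]_n) :
    Prop :=
  forall i j, dotv (u j) (b i) = - (i == j)%:R.

(* p = (I, c), where c i stands for alpha_i if i is not in I, and for beta_i
   if i is in I. *)
Definition cone_decomp (R : realType) (n : nat) (b u : 'I_n -> 'cV[R]_n)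
    (x : 'cV[R]_n) (p : {set 'I_n} * {ffun 'I_n -> R}) : Prop :=
  [/\ x = \sum_(i | i \notin p.1) p.2 i *: b i
        + \sum_(j in p.1) p.2 j *: u j,
      forall i, i \notin p.1 -> 0 <= p.2 i
    & forall j, j \in p.1 -> 0 < p.2 j].

(* When b is a basis and u satisfies assoc_vectors, every x has exactly one
   decomposition, so the default value of xget is never used. *)
Definition cone_coord (R : realType) (n : nat) (b u : 'I_n -> 'cV[R]_n)
    (x : 'cV[R]_n) : {set 'I_n} * {ffun 'I_n -> R} :=
  xget (finset.set0, [ffun=> 0]) [set p | cone_decomp b u x p].

Definition Iminus (R : realType) (n : nat) (b u : 'I_n -> 'cV[R]_n)
    (x : 'cV[R]_n) : {set 'I_n} :=
  (cone_coord b u x).1.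

Definition Iplus (R : realType) (n : nat) (b u : 'I_n -> 'cV[R]_n)
    (x : 'cV[R]_n) : {set 'I_n} :=
  [set i | (i \notin Iminus b u x) && (0 < (cone_coord b u x).2 i)]%SET.

Definition Ibullet (R : realType) (n : nat) (b u : 'I_n -> 'cV[R]_n)
    (x : 'cV[R]_n) : {set 'I_n} :=
  [set i | (i \notin Iminus b u x) && ((cone_coord b u x).2 i == 0)]%SET.

Definition colsmx (R : realType) (n : nat) (b : 'I_n -> 'cV[R]_n)
    (J : {set 'I_n}) : 'M[R]_(n, #|J|) :=
  \matrix_(i, k) b (enum_val k) i 0.

(* For m = 0 this is the zero map, as a product through an empty dimension. *)
Definition range_proj (R : realType) (n m : nat) (B : 'M[R]_(n, m))
    (y : 'cV[R]_n) : 'cV[R]_n :=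
  B *m invmx (B^T *m B) *m B^T *m y.

Definition is_strict_diff (R : realType) (n : nat)
    (f : 'cV[R]_n -> 'cV[R]_n) (x : 'cV[R]_n)
    (L : {linear 'cV[R]_n -> 'cV[R]_n}) : Prop :=
  (enorm (p.1 - p.2))^-1 *: (f p.1 - f p.2 - L (p.1 - p.2))
    @[p --> within [set p : 'cV[R]_n * 'cV[R]_n | p.1 <> p.2] (nbhs (x, x))]
  --> (0 : 'cV[R]_n).

Definition dir_quot (R : realType) (n : nat) (f : 'cV[R]_n -> 'cV[R]_n)
    (x h : 'cV[R]_n) (t : R) : 'cV[R]_n :=
  t^-1 *: (f (x + t *: h) - f x).

(* The library's derivable and 'D_h f are two-sided; here t decreases to 0. *)
Definition dir_derivable (R : realType) (n : nat) (f : 'cV[R]_n -> 'cV[R]_n)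
    (x h : 'cV[R]_n) : Prop :=
  cvg (dir_quot f x h t @[t --> 0^'+]).

Definition dir_derive (R : realType) (n : nat) (f : 'cV[R]_n -> 'cV[R]_n)
    (x h : 'cV[R]_n) : 'cV[R]_n :=
  lim (dir_quot f x h t @[t --> 0^'+]).

Definition dir_decomp (R : realType) (n : nat) (b u : 'I_n -> 'cV[R]_n)
    (x h : 'cV[R]_n) (A B : {set 'I_n}) : Prop :=
  [/\ A \subset Ibullet b u x, B \subset Ibullet b u x, [disjoint A & B]%B
    & exists alpha beta : 'I_n -> R,
      [/\ h = \sum_(i in Iplus b u x) alpha i *: b i
            + \sum_(i in A) alpha i *: b i
            + \sum_(j in B) beta j *: u j
            + \sum_(j in Iminus b u x) beta j *: u j,
          forall i, i \in A -> 0 < alpha i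
        & forall j, j \in B -> 0 < beta j]].

(* Main.v *)
(* Every x splits as p + q with p = sum_i a_i b_i in K, q = sum_i c_i u_i in the
   polar cone, a, c >= 0 and a_i c_i = 0 for all i: these are the optimality
   conditions of the projection, and conversely they force p = P_K(x). The
   coordinates a_i and c_i are continuous in x because P_K is nonexpansive, so
   those that are positive at x stay positive nearby. If no index has
   a_i = c_i = 0, the active face is locally constant and P_K is locally the
   orthogonal projection onto its span. In general, moving from x along h for a
   short time changes the coordinates affinely, so t -> P_K(x + t h) is affine
   near t = 0+. For an index k with a_k = c_k = 0, the one-sided derivative is
   b_k along b_k, but along - b_k its k-th coordinate is nonnegative, so P_K is
   not differentiable. *)
Require Import Defs.
From HB Require Import structures.
From mathcomp Require Import all_boot all_order all_algebra.
From mathcomp Require Import all_classical all_reals all_analysis.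
From mathcomp Require Import lra ring.

Set Implicit Arguments.
Unset Strict Implicit.
Unset Printing Implicit Defensive.

Import Order.TTheory GRing.Theory Num.Theory.
Import numFieldNormedType.Exports.

Local Open Scope classical_set_scope.
Local Open Scope ring_scope.

(** * The Euclidean inner product *)

Section InnerProduct.
Variables (R : realType) (n : nat).
Implicit Types (x y z : 'cV[R]_n) (a : R).

Lemma dotv_mulmx x y : dotv x y = (x^T *m y) 0 0.
Proof. by rewrite mxE; apply: eq_bigr => i _; rewrite mxE. Qed.

Lemma dotvC x y : dotv x y = dotv y x.
Proof. by apply: eq_bigr => i _; rewrite mulrC. Qed.

Lemma dotvDr x y z : dotv x (y + z) = dotv x y + dotv x z.
Proof. by rewrite !dotv_mulmx mulmxDr mxE. Qed.

Lemma dotvZr a x y : dotv x (a *: y) = a * dotv x y.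
Proof. by rewrite !dotv_mulmx -scalemxAr mxE. Qed.

Lemma dotv0r x : dotv x 0 = 0.
Proof. by rewrite -(scale0r 0) dotvZr mul0r. Qed.

Lemma dotvNr x y : dotv x (- y) = - dotv x y.
Proof. by rewrite -scaleN1r dotvZr mulN1r. Qed.

Lemma dotvBr x y z : dotv x (y - z) = dotv x y - dotv x z.
Proof. by rewrite dotvDr dotvNr. Qed.

Lemma dotvDl x y z : dotv (x + y) z = dotv x z + dotv y z.
Proof. by rewrite dotvC dotvDr !(dotvC z). Qed.

Lemma dotvZl a x y : dotv (a *: x) y = a * dotv x y.
Proof. by rewrite dotvC dotvZr (dotvC y). Qed.

Lemma dotvNl x y : dotv (- x) y = - dotv x y.
Proof. by rewrite dotvC dotvNr (dotvC y). Qed.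

Lemma dotvBl x y z : dotv (x - y) z = dotv x z - dotv y z.
Proof. by rewrite dotvDl dotvNl. Qed.

Lemma dotv_sumr (I : Type) (r : seq I) (P : pred I) (F : I -> 'cV[R]_n) x :
  dotv x (\sum_(i <- r | P i) F i) = \sum_(i <- r | P i) dotv x (F i).
Proof.
apply: (big_morph (dotv x)) => [y z|]; first exact: dotvDr.
exact: dotv0r.
Qed.

Lemma dotv_ge0 x : 0 <= dotv x x.
Proof. by apply: sumr_ge0 => i _; rewrite -expr2 sqr_ge0. Qed.

Lemma dotv_eq0 x : dotv x x = 0 -> x = 0.
Proof.
move=> /eqP; rewrite psumr_eq0 => [/allP x0|i _]; last first.
  by rewrite -expr2 sqr_ge0.
apply/colP => i; rewrite mxE; apply/eqP.
by have := x0 i (mem_index_enum i); rewrite /= mulf_eq0 orbb.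
Qed.

Lemma enorm_le x y : (enorm x <= enorm y) = (dotv x x <= dotv y y).
Proof. by rewrite /enorm ler_sqrt ?dotv_ge0. Qed.

Lemma sqr_coord_le_dotv x i : x i 0 ^+ 2 <= dotv x x.
Proof.
rewrite /dotv (bigD1 i) //= -expr2 lerDl; apply: sumr_ge0 => j _.
by rewrite -expr2 sqr_ge0.
Qed.

Lemma cvg_dotv (T : Type) (F : set_system T) (f g : T -> 'cV[R]_n) x y :
  Filter F -> f @ F --> x -> g @ F --> y ->
  dotv (f t) (g t) @[t --> F] --> dotv x y.
Proof.
move=> FF fx gy; rewrite /dotv.
apply: (cvg_big (@add_continuous _)) => i _.
by apply: cvgM; [exact: (cvg_comp _ _ fx (@coord_continuous _ _ _ i 0 x))
               | exact: (cvg_comp _ _ gy (@coord_continuous _ _ _ i 0 y))].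
Qed.

Lemma cvg_lincomb (T : Type) (F : set_system T) (v : 'I_n -> 'cV[R]_n)
    (f : 'I_n -> T -> R) (a : 'I_n -> R) :
  Filter F -> (forall i, f i @ F --> a i) ->
  \sum_i f i t *: v i @[t --> F] --> \sum_i a i *: v i.
Proof.
move=> FF fa; apply: (cvg_big (@add_continuous _)) => i _.
by apply: cvgZr_tmp; exact: fa.
Qed.

End InnerProduct.

(** * Dual bases and orthogonal projection onto spanned faces *)

Section DualBases.
Variables (R : realType) (n : nat) (b u : 'I_n -> 'cV[R]_n).
Hypothesis u_assoc : assoc_vectors b u.

Lemma assoc_vectorsC : assoc_vectors u b.
Proof. by move=> i j; rewrite dotvC u_assoc eq_sym. Qed.

Lemma dotv_assoc_sum (a : 'I_n -> R) j :
  dotv (u j) (\sum_i a i *: b i) = - a j.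
Proof.
rewrite dotv_sumr (bigD1 j) //= dotvZr u_assoc eqxx mulrN1 big1 ?addr0 // => i.
by move=> /negbTE ij; rewrite dotvZr u_assoc ij oppr0 mulr0.
Qed.

(** The square matrices with columns [b i] and rows [- u i] satisfy [U *m B = 1], hence also
    [B *m U = 1]; applied to [y] this is the expansion. *)
Lemma assoc_expand y : y = \sum_i (- dotv (u i) y) *: b i.
Proof.
pose B := \matrix_(k, i) b i k 0; pose U := \matrix_(i, k) - u i k 0.
have UB1 : U *m B = 1%:M.
  apply/matrixP => j i; rewrite !mxE -[RHS]opprK.
  rewrite eq_sym -(u_assoc i j) /dotv -sumrN.
  by apply: eq_bigr => k _; rewrite !mxE mulNr.
rewrite -{1}[y]mul1mx -(mulmx1C UB1) -mulmxA; apply/colP => k.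
rewrite mxE summxE; apply: eq_bigr => i _; rewrite !mxE mulrC /dotv -sumrN.
by congr (_ * _); apply: eq_bigr => l _; rewrite mxE mulNr.
Qed.

Lemma colsmx_mul (J : {set 'I_n}) (d : 'cV[R]_#|J|) :
  colsmx b J *m d = \sum_k d k 0 *: b (enum_val k).
Proof.
apply/colP => i; rewrite mxE summxE.
by apply: eq_bigr => k _; rewrite !mxE mulrC.
Qed.

(** A left kernel vector [v] of the Gram matrix gives [B *m v^T] norm zero; pairing with
    [u (enum_val k)] then shows that each entry of [v] vanishes. *)
Lemma colsmx_gram_unit (J : {set 'I_n}) :
  (colsmx b J)^T *m colsmx b J \in unitmx.
Proof.
rewrite unitmxE unitfE; apply/negP => /det0P [v v0 vBB].
have Bv : colsmx b J *m v^T = 0.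
  apply: dotv_eq0; rewrite dotv_mulmx trmx_mul trmxK.
  by rewrite mulmxA -(mulmxA v) vBB mul0mx mxE.
case/negP: v0; apply/eqP/rowP => k; rewrite mxE; apply: oppr_inj.
rewrite oppr0 -[RHS](dotv0r (u (enum_val k))) -Bv.
rewrite colsmx_mul dotv_sumr (bigD1 k) //= dotvZr u_assoc eqxx mulrN1 mxE.
rewrite big1 ?addr0 // => l lk.
by rewrite dotvZr u_assoc (inj_eq enum_val_inj) (negbTE lk) oppr0 mulr0.
Qed.

(** [B^T] kills the [u] part, since [b k] with [k] in [J] is orthogonal to [u i] with [i] outside
    [J]; the [b] part is [B *m d], on which the inverse Gram matrix cancels. *)
Lemma range_projE (J : {set 'I_n}) (a c : 'I_n -> R) :
  (forall i, i \notin J -> a i = 0) -> (forall i, i \in J -> c i = 0) ->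
  range_proj (colsmx b J) (\sum_i a i *: b i + \sum_i c i *: u i) =
  \sum_i a i *: b i.
Proof.
move=> a0 c0; rewrite /range_proj; set B := colsmx b J.
have -> : \sum_i a i *: b i = B *m \col_k a (enum_val k).
  rewrite colsmx_mul (bigID (mem J)) /= [X in _ + X]big1 ?addr0; last first.
    by move=> i /a0 ->; rewrite scale0r.
  by rewrite big_enum_val /=; apply: eq_bigr => k _; rewrite mxE.
have BTc : B^T *m (\sum_i c i *: u i) = 0.
  apply/colP => k; rewrite mxE [RHS]mxE.
  transitivity (dotv (b (enum_val k)) (\sum_i c i *: u i)).
    by apply: eq_bigr => l _; rewrite !mxE.
  rewrite dotv_sumr big1 // => i _; rewrite dotvZr dotvC u_assoc.
  by case: eqP => [<-|_]; rewrite ?oppr0 ?mulr0 // c0 ?mul0r ?enum_valP.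
rewrite mulmxDr -[X in _ + X]mulmxA BTc mulmx0 addr0.
rewrite -!mulmxA [X in invmx _ *m X]mulmxA mulKmx //.
exact: colsmx_gram_unit.
Qed.
End DualBases.

(** * Scalar optimality conditions and one-sided derivatives *)

(** Here [a] is one coordinate of a nearest point, and [s * (s * N - 2 * g)] is the change of the
    squared distance when it moves by [s]. A positive [g] would reward a step forward, and a
    negative [g] with [0 < a] a step backward. *)
Lemma quadratic_min_at0 (R : realFieldType) (a N g : R) :
  0 <= a -> 0 <= N ->
  (forall s, 0 <= a + s -> 0 <= s * (s * N - 2 * g)) -> g <= 0 /\ a * g = 0.
Proof.
move=> a0 N0 opt; have N1 : 0 < N + 1 by lra.
have g0 : g <= 0.
  (* Dividing by [N + 1] covers the case [N = 0] and makes [s * N] less than [2 * g]. *)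
  rewrite leNgt; apply/negP => g0; pose s := g / (N + 1).
  have s0 : 0 < s by rewrite divr_gt0.
  have sN : s * (N + 1) = g by rewrite mulfVK ?gt_eqF.
  have as0 : 0 <= a + s by rewrite addr_ge0 // ltW.
  have := opt s as0; rewrite pmulr_rge0 //; lra.
split=> //; apply/eqP; rewrite mulf_eq0 orbC; apply/norP => -[gn0 an0].
have {gn0}g0' : g < 0 by rewrite lt_neqAle gn0.
have {an0}a0' : 0 < a by rewrite lt_neqAle eq_sym an0.
(* The bound by [a] keeps the coordinate [a - s] nonnegative. *)
pose s := Num.min a (- g / (N + 1)).
have s0 : 0 < s by rewrite lt_min a0' divr_gt0 // oppr_gt0.
have sa : s <= a by rewrite ge_min lexx.
have sN : s * (N + 1) <= - g.
  by rewrite -ler_pdivlMr // ge_min lexx orbT.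
have as0 : 0 <= a + - s by rewrite subr_ge0.
have := opt (- s) as0; rewrite mulNr oppr_ge0 pmulr_rle0 //; lra.
Qed.

Lemma differentiable_dir_derive (R : realType) (n : nat)
    (f : 'cV[R]_n -> 'cV[R]_n) x h :
  differentiable f x -> dir_derive f x h = 'd f x h.
Proof.
move=> df; rewrite -deriveE //; apply: norm_cvg_lim.
have D := @diff_derivable _ _ _ f x h df : _ --> 'D_h f x.
move=> S /D; rewrite /= !near_simpl !near_withinE.
apply: filterS => t St t0; rewrite /dir_quot (addrC x); apply: St.
by rewrite gt_eqF.
Qed.

(** * Existence and characterization of the nearest point *)

Section SimplicialCone.
Variables (R : realType) (n : nat) (b u : 'I_n -> 'cV[R]_n).
Hypothesis u_assoc : assoc_vectors b u.

(** Two total coefficient functions with zero products replace the index set [I], so that both can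
    vary continuously with [x]. *)
Definition compl_decomp (x : 'cV[R]_n) (a c : 'I_n -> R) : Prop :=
  [/\ x = \sum_i a i *: b i + \sum_i c i *: u i,
      forall i, 0 <= a i, forall i, 0 <= c i & forall i, a i * c i = 0].

Definition is_nearest (K : set 'cV[R]_n) (x p : 'cV[R]_n) : Prop :=
  K p /\ forall z, K z -> dotv (x - p) (x - p) <= dotv (x - z) (x - z).

(** The squared distance attains its minimum over the compact box of coefficients [0 <= a i <= M i];
    cone points with a coefficient outside the box are farther from [x] than the origin is. *)
Lemma nearest_existence x : exists p, is_nearest (cone b) x p.
Proof.
pose M i := dotv (u i - x) (u i - x) / 2.
pose f (a : 'rV[R]_n) :=
  dotv (x - \sum_i a 0 i *: b i) (x - \sum_i a 0 i *: b i).
pose A := [set a : 'rV[R]_n | forall i, `[0, M i]%classic (a ord0 i)].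
have M0 i : 0 <= M i by rewrite divr_ge0 ?dotv_ge0.
have A0 : A 0 by move=> i /=; rewrite mxE in_itv /= lexx M0.
have f_cont : continuous f.
  have cg : continuous (fun a : 'rV[R]_n => x - \sum_i a 0 i *: b i).
    move=> a.
    have sum_cvg : (fun t : 'rV[R]_n => \sum_i t 0 i *: b i) @ a -->
        \sum_i a 0 i *: b i.
      apply: (@cvg_lincomb R n _ (nbhs a) b (fun i t => t 0 i)) => i.
      exact: coord_continuous.
    by apply: (cvgB (cvg_cst x) sum_cvg).
  by move=> a; exact: (@cvg_dotv R n _ (nbhs a) _ _ _ _ _ (cg a) (cg a)).
have [|||a aA amin] := @EVT_min_rV _ _ f A.
- by exists 0.
- apply: (@rV_compact R n (fun i => `[0, M i]%classic)) => i.
  exact: segment_compact.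
- exact: continuous_subspaceT.
exists (\sum_i a 0 i *: b i); split.
  exists (a 0); split=> // i.
  by move: aA; rewrite inE => /(_ i) /=; rewrite in_itv /= => /andP[].
move=> z [al [al0 zE]].
have [alM|/existsNP [i /negP]] := pselect (forall i, al i <= M i).
  have -> : z = \sum_i (\row_i al i) 0 i *: b i.
    by rewrite zE; apply: eq_bigr => i _; rewrite mxE.
  by apply: amin; rewrite inE => i /=; rewrite mxE in_itv /= al0 alM.
rewrite -ltNge => Mi.
have fa : f a <= dotv x x.
  have := amin 0; rewrite inE => /(_ A0); rewrite {2}/f big1 ?subr0 // => j _.
  by rewrite mxE scale0r.
apply: (le_trans fa).
have alE : dotv (u i) z = - al i by rewrite zE (dotv_assoc_sum u_assoc).
(* Expanding this square bounds [dotv (x - z) (x - z)] below by [2 * al i + 2 * dotv (u i) x - dotv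
   (u i) (u i)], which exceeds [dotv x x] once [al i] exceeds [M i]. *)
have := dotv_ge0 (u i - (x - z)).
move: Mi; rewrite /M !(dotvBl, dotvBr) !(dotvC _ (u i)) alE (dotvC z x).
lra.
Qed.

Lemma metric_projP x : is_nearest (cone b) x (metric_proj (cone b) x).
Proof.
rewrite /metric_proj; set S := [set p | _].
have : S (xget 0 S).
  have [p [Kp pmin]] := nearest_existence x.
  by apply: (@xgetPex _ 0 S); exists p; split=> // z /pmin; rewrite enorm_le.
by move=> [? zmin]; split=> // z /zmin; rewrite enorm_le.
Qed.

(** Moving a nearest point along a single [b i] stays in the cone as long as its coordinate is
    nonnegative, so [quadratic_min_at0] applies to each index separately. The residual is expanded
    in the dual basis [u]. *)
Lemma compl_decomp_existence x : exists a c, compl_decomp x a c.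
Proof.
have [p [[a [a0 pE]] pmin]] := nearest_existence x.
exists a, (fun i => - dotv (b i) (x - p)).
have xpE := assoc_expand (assoc_vectorsC u_assoc) (x - p).
have opt i s : 0 <= a i + s ->
    0 <= s * (s * dotv (b i) (b i) - 2 * dotv (b i) (x - p)).
  move=> ais; have Kp : cone b (p + s *: b i).
    exists (fun j => a j + if j == i then s else 0); split.
      by move=> j; case: eqP => [-> //|_]; rewrite addr0.
    under eq_bigr do rewrite scalerDl.
    rewrite big_split /= -pE; congr (_ + _).
    rewrite (bigD1 i) //= eqxx big1 ?addr0 // => j /negbTE ->.
    by rewrite scale0r.
  move: (pmin _ Kp); rewrite opprD addrA; move: (x - p) => d.
  rewrite !(dotvBl, dotvBr, dotvZl, dotvZr) (dotvC d (b i)); lra.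
have kkt i := quadratic_min_at0 (a0 i) (dotv_ge0 _) (opt i).
split=> // [|i|i].
- by rewrite -xpE -pE addrC subrK.
- by rewrite oppr_ge0; case: (kkt i).
- by rewrite mulrN; case: (kkt i) => _ ->; rewrite oppr0.
Qed.

(** Complementarity makes [dotv (q - p) (x - q)] the sum of the [c i * al i], hence nonnegative.
    Then the squared distance from [x] to [p] exceeds that to [q] by at least the squared norm of
    [q - p], and minimality of [p] forces [p = q]. *)
Lemma metric_proj_compl x a c :
  compl_decomp x a c -> metric_proj (cone b) x = \sum_i a i *: b i.
Proof.
move=> [xE a0 c0 ac]; have [[al [al0 pE]]] := metric_projP x.
set p := metric_proj _ _ in pE *; set q := \sum_i a i *: b i.
have Kq : cone b q by exists a.
move=> /(_ _ Kq) le_pq.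
have xq : x - q = \sum_i c i *: u i by rewrite xE addrC addKr.
have qp : q - p = \sum_i (a i - al i) *: b i.
  by rewrite pE -sumrB; apply: eq_bigr => i _; rewrite scalerBl.
have ge0 : 0 <= dotv (q - p) (x - q).
  rewrite xq dotv_sumr; apply: sumr_ge0 => i _.
  rewrite dotvZr dotvC qp (dotv_assoc_sum u_assoc) opprB mulrBr.
  by rewrite [X in _ - X]mulrC ac subr0 mulr_ge0.
apply/esym/subr0_eq/dotv_eq0/le_anti; rewrite dotv_ge0 andbT.
move: le_pq; have -> : x - p = (x - q) + (q - p) by rewrite addrA subrK.
move: ge0; move: (q - p) (x - q) => d e ge0.
rewrite !(dotvDl, dotvDr) (dotvC e d); lra.
Qed.

(* Coordinates of the projection in [b] and of the residual in [u]; the signs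
   come from [<u_j, b_i> = - delta_ij]. *)
Definition acoord x i := - dotv (u i) (metric_proj (cone b) x).
Definition ccoord x i := - dotv (b i) (x - metric_proj (cone b) x).

Lemma acoordE x a c : compl_decomp x a c -> acoord x =1 a.
Proof.
move=> xac i; rewrite /acoord (metric_proj_compl xac).
by rewrite (dotv_assoc_sum u_assoc) opprK.
Qed.

Lemma ccoordE x a c : compl_decomp x a c -> ccoord x =1 c.
Proof.
move=> xac i; rewrite /ccoord (metric_proj_compl xac).
have [{1}-> _ _ _] := xac.
by rewrite addrC addKr (dotv_assoc_sum (assoc_vectorsC u_assoc)) opprK.
Qed.

Lemma compl_decomp_coord x : compl_decomp x (acoord x) (ccoord x).
Proof.
have [a [c xac]] := compl_decomp_existence x.
have -> : acoord x = a by apply/funext/(acoordE xac).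
by have -> : ccoord x = c by apply/funext/(ccoordE xac).
Qed.

(** * Nonexpansiveness and continuity of the coordinates *)

(** With [d] the difference of the projections and [e] that of the residuals, complementarity turns
    [dotv d e] into a sum of terms [ccoord y i * acoord x i + ccoord x i * acoord y i], so [d + e]
    is at least as long as [d]. *)
Lemma metric_proj_nonexpansive x y :
  dotv (metric_proj (cone b) y - metric_proj (cone b) x)
       (metric_proj (cone b) y - metric_proj (cone b) x) <=
  dotv (y - x) (y - x).
Proof.
set d := _ - _.
have [xE ax0 cx0 xac] := compl_decomp_coord x.
have [yE ay0 cy0 yac] := compl_decomp_coord y.
have Px := metric_proj_compl (compl_decomp_coord x).
have Py := metric_proj_compl (compl_decomp_coord y).
pose e := (y - metric_proj (cone b) y) - (x - metric_proj (cone b) x).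
have de : 0 <= dotv d e.
  have -> : e = \sum_i (ccoord y i - ccoord x i) *: u i.
    under eq_bigr do rewrite scalerBl.
    rewrite /e sumrB Px Py {1}xE {1}yE.
    by rewrite !(addrC (\sum_i acoord _ i *: _)) !addrK.
  rewrite dotv_sumr; apply: sumr_ge0 => i _.
  rewrite dotvZr dotvC dotvBr.
  have -> : dotv (u i) (metric_proj (cone b) y) = - acoord y i by rewrite opprK.
  have -> : dotv (u i) (metric_proj (cone b) x) = - acoord x i by rewrite opprK.
  have := xac i; have := yac i; have := ax0 i; have := ay0 i.
  have := cx0 i; have := cy0 i; nra.
have -> : y - x = d + e.
  by rewrite /d /e; apply/colP => k; rewrite !mxE; ring.
have := dotv_ge0 e; move: d e de => d e de.
rewrite !(dotvDl, dotvDr) (dotvC e d); lra.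
Qed.

Lemma metric_proj_continuous : continuous (metric_proj (cone b)).
Proof.
move=> x; apply/(@cvg_ballP R _ _ (nbhs x)) => e e0.
have d0 : dotv (y - x) (y - x) @[y --> x] --> (0 : R).
  have yx : (fun y => y - x) @ x --> (0 : 'cV[R]_n).
    rewrite -(subrr x); exact: (cvgB cvg_id (cvg_cst x)).
  rewrite -(dotv0r (0 : 'cV[R]_n)).
  exact: (@cvg_dotv R n _ (nbhs x) _ _ _ _ _ yx yx).
near=> y; split=> // i j.
(* Balls are coordinatewise here; each squared coordinate is at most the squared Euclidean norm. *)
rewrite (ord1 j) /ball /= -ltr_sqr ?nnegrE ?normr_ge0 ?(ltW e0) //.
rewrite real_normK ?num_real //.
have := sqr_coord_le_dotv (metric_proj (cone b) y - metric_proj (cone b) x) i.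
rewrite !mxE -sqrrN opprB => /le_lt_trans; apply.
apply: (le_lt_trans (metric_proj_nonexpansive x y)).
near: y; apply: (@cvgr_lt R _ (nbhs x) _ _ _ d0); exact: exprn_gt0.
Unshelve. all: by end_near.
Qed.

Lemma acoord_continuous i : continuous (acoord^~ i).
Proof.
move=> x; exact: (cvgN (@cvg_dotv R n _ (nbhs x) _ _ _ _ _
  (cvg_cst (u i)) (@metric_proj_continuous x))).
Qed.

Lemma ccoord_continuous i : continuous (ccoord^~ i).
Proof.
move=> x; exact: (cvgN (@cvg_dotv R n _ (nbhs x) _ _ _ _ _
  (cvg_cst (b i)) (cvgB cvg_id (@metric_proj_continuous x)))).
Qed.

Lemma near_coord_gt0 x :
  \forall y \near x, forall i,
    (0 < acoord x i -> 0 < acoord y i) /\ (0 < ccoord x i -> 0 < ccoord y i).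
Proof.
have near_gt0 (f : 'cV[R]_n -> R) : continuous f ->
    \forall y \near x, 0 < f x -> 0 < f y.
  move=> fc; case: (boolP (0 < f x)) => [fx0|_]; last by near=> y.
  by apply: filterS (@cvgr_gt R _ (nbhs x) _ _ _ (fc x) _ fx0).
apply: (@filter_forall _ _ _ (nbhs x)) => i; apply: filterI; apply: near_gt0.
- exact: acoord_continuous.
- exact: ccoord_continuous.
Unshelve. all: by end_near.
Qed.

(** * The index sets as sign conditions on the coordinates *)

Lemma cone_decomp_compl x p : cone_decomp b u x p ->
  compl_decomp x (fun i => if i \notin p.1 then p.2 i else 0)
                 (fun i => if i \in p.1 then p.2 i else 0).
Proof.
move=> [xE a0 c0]; split.
- rewrite xE big_mkcond [X in _ + X]big_mkcond.
  by congr (_ + _); apply: eq_bigr => i _; case: ifP; rewrite // scale0r.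
- by move=> i; case: ifP => // /a0.
- by move=> i; case: ifP => // /c0/ltW.
- by move=> i; case: (i \in p.1); rewrite ?mul0r ?mulr0.
Qed.

(** Taking [I] to be the indices with [0 < ccoord x i] gives a decomposition, so [xget] does not
    fall back on its default. *)
Lemma cone_coordP x : cone_decomp b u x (cone_coord b u x).
Proof.
apply: (@xgetPex _ _ [set p | cone_decomp b u x p]).
have [xE a0 c0 ac] := compl_decomp_coord x.
have ac0 i : 0 < ccoord x i -> acoord x i = 0.
  move=> ci; apply/eqP; have /eqP := ac i.
  by rewrite mulf_eq0 (gt_eqF ci) orbF.
exists ([set i | 0 < ccoord x i]%SET,
        [ffun i => if 0 < ccoord x i then ccoord x i else acoord x i]).
split=> [|i|i] /=; last 2 first.
- by rewrite inE ffunE => /negbTE ->.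
- by rewrite inE ffunE => ci; rewrite ci.
rewrite {1}xE; congr (_ + _); rewrite [RHS]big_mkcond; apply: eq_bigr => i _.
  rewrite /= inE ffunE; case: (boolP (0 < ccoord x i)) => //= /ac0 ->.
  by rewrite scale0r.
rewrite /= inE ffunE; case: (boolP (0 < ccoord x i)) => //= ci.
by rewrite (_ : ccoord x i = 0) ?scale0r //; apply/le_anti; rewrite c0 leNgt ci.
Qed.

Lemma in_Iminus x i : (i \in Iminus b u x) = (0 < ccoord x i).
Proof.
have xp := cone_coordP x; rewrite (ccoordE (cone_decomp_compl xp)).
have [_ _ c0] := xp; rewrite /Iminus.
by case: ifPn => [/c0 ->|]; rewrite ?ltxx.
Qed.

Lemma in_Iplus x i : (i \in Iplus b u x) = (0 < acoord x i).
Proof.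
have xp := cone_coordP x; rewrite (acoordE (cone_decomp_compl xp)).
by rewrite inE /Iminus; case: ifPn; rewrite ?ltxx.
Qed.

Lemma in_Ibullet x i :
  (i \in Ibullet b u x) = (acoord x i == 0) && (ccoord x i == 0).
Proof.
have xp := cone_coordP x; rewrite (acoordE (cone_decomp_compl xp)).
rewrite (ccoordE (cone_decomp_compl xp)) inE /Iminus.
have [_ _ c0] := xp.
case: ifPn => [iI|/negPn iI] /=; first by rewrite (negbTE iI) eqxx andbT.
by rewrite iI eqxx /= gt_eqF ?c0.
Qed.

(** * Strict differentiability when [Ibullet] is empty *)

(** Each index has one positive coordinate at [x]. It stays positive nearby, and complementarity
    kills the other one, so [y] projects onto the same face as [x]. *)
Lemma near_metric_proj_linear x : Ibullet b u x = finset.set0 ->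
  \forall y \near x,
    metric_proj (cone b) y = range_proj (colsmx b (Iplus b u x)) y.
Proof.
move=> bullet0; apply: filterS (near_coord_gt0 x) => y sgn.
have yd := compl_decomp_coord y; have [yE ay0 cy0 acy] := yd.
have [_ ax0 cx0 _] := compl_decomp_coord x.
rewrite {1}(metric_proj_compl yd) {2}yE (range_projE u_assoc) // => i;
  rewrite in_Iplus => ai; have [sa sc] := sgn i; have /eqP := acy i.
- have : i \notin Ibullet b u x by rewrite bullet0 inE.
  have ax : acoord x i = 0 by apply/le_anti; rewrite ax0 leNgt ai.
  rewrite in_Ibullet ax eqxx /= => cxi.
  have /sc cyi : 0 < ccoord x i by rewrite lt_neqAle eq_sym cxi cx0.
  by rewrite mulf_eq0 (gt_eqF cyi) orbF => /eqP.
- by rewrite mulf_eq0 (gt_eqF (sa ai)) => /eqP.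
Qed.

Lemma metric_proj_strict_diff x : Ibullet b u x = finset.set0 ->
  exists L : {linear 'cV[R]_n -> 'cV[R]_n},
    is_strict_diff (metric_proj (cone b)) x L /\
    forall y, L y = range_proj (colsmx b (Iplus b u x)) y.
Proof.
move=> /near_metric_proj_linear near_lin.
pose B := colsmx b (Iplus b u x).
exists (mulmx (B *m invmx (B^T *m B) *m B^T)); split=> //.
(* Near [(x, x)] both points lie where the projection is linear, so the quotient is exactly zero. *)
apply: cvg_near_cst; rewrite near_withinE.
have /filterS : \forall p \near (x, x),
    metric_proj (cone b) p.1 = range_proj B p.1 /\
    metric_proj (cone b) p.2 = range_proj B p.2.
  pose S := [set y | metric_proj (cone b) y = range_proj B y].
  by exists (S, S) => // -[? ?] [].
by apply=> -[y z] /= [-> ->] _; rewrite mulmxBr subrr scaler0.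
Qed.

(** * Directional derivatives *)

(* These are the conditions for [acoord x + t a] and [ccoord x + t c] to be
   nonnegative and complementary for all small [t > 0]. *)
Definition tangent_decomp (x h : 'cV[R]_n) (a c : 'I_n -> R) : Prop :=
  h = \sum_i a i *: b i + \sum_i c i *: u i /\
  forall i, [/\ acoord x i = 0 -> 0 <= a i, ccoord x i = 0 -> 0 <= c i,
    acoord x i * c i = 0, a i * ccoord x i = 0 & a i * c i = 0].

Lemma near0_affine_ge0 (s r : R) : 0 <= s -> (s = 0 -> 0 <= r) ->
  \forall t \near 0^'+, 0 <= s + t * r.
Proof.
rewrite le_eqVlt => /predU1P[<- /(_ erefl) r0|s0 _].
  by near=> t; rewrite add0r mulr_ge0 //; apply: ltW;
    near: t; exact: nbhs_right_gt.
have lim_s : s + t * r @[t --> 0^'+] --> s.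
  apply: cvg_at_right_filter.
  have : (fun t : R => s + t * r) @ (0 : R) --> s + 0 * r.
    apply: cvgD; first exact: cvg_cst.
    by apply: cvgM; [exact: cvg_id | exact: cvg_cst].
  by rewrite mul0r addr0.
by apply: filterS (cvgr_gt _ lim_s _ s0) => t /ltW.
Unshelve. all: by end_near.
Qed.

(** For small [t] the affine coordinates form a complementary decomposition of [x + t *: h], so the
    difference quotient is constant in [t]. *)
Lemma tangent_dir_quot x h a c : tangent_decomp x h a c ->
  \forall t \near 0^'+,
    dir_quot (metric_proj (cone b)) x h t = \sum_i a i *: b i.
Proof.
move=> [hE tan]; have [xE ax0 cx0 acx] := compl_decomp_coord x.
have near_a : \forall t \near 0^'+, forall i, 0 <= acoord x i + t * a i.
  by apply: filter_forall => i; apply: near0_affine_ge0 => //; case: (tan i).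
have near_c : \forall t \near 0^'+, forall i, 0 <= ccoord x i + t * c i.
  by apply: filter_forall => i; apply: near0_affine_ge0 => //; case: (tan i).
near=> t.
have t0 : 0 < t by near: t; exact: nbhs_right_gt.
have xth : compl_decomp (x + t *: h)
    (fun i => acoord x i + t * a i) (fun i => ccoord x i + t * c i).
  split.
  - under eq_bigr do rewrite scalerDl -scalerA.
    under [X in _ = _ + X]eq_bigr do rewrite scalerDl -scalerA.
    by rewrite !big_split /= -!scaler_sumr addrACA -xE -scalerDr -hE.
  - by near: t.
  - by near: t.
  - move=> i; have [_ _ ac ca aa] := tan i; have := acx i; nra.
rewrite /dir_quot (metric_proj_compl xth).
rewrite (metric_proj_compl (compl_decomp_coord x)).
rewrite -sumrB scaler_sumr; apply: eq_bigr => i _.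
by rewrite scalerDl addrAC subrr add0r scalerA mulKf ?gt_eqF.
Unshelve. all: by end_near.
Qed.

(** A single [t], small enough that positive coordinates stay positive, suffices: the witnesses are
    the difference quotients of the coordinates between [x] and [x + t *: h]. *)
Lemma tangent_existence x h : exists a c, tangent_decomp x h a c.
Proof.
have near_xth : \forall t \near 0^'+, forall i,
    (0 < acoord x i -> 0 < acoord (x + t *: h) i) /\
    (0 < ccoord x i -> 0 < ccoord (x + t *: h) i).
  have lim_x : x + t *: h @[t --> (0 : R)^'+] --> x.
    apply: cvg_at_right_filter.
    have : (fun t : R => x + t *: h) @ (0 : R) --> x + 0 *: h.
      by apply: cvgD; [exact: cvg_cst | apply: cvgZr_tmp; exact: cvg_id].
    by rewrite scale0r addr0.
  exact: (lim_x _ (near_coord_gt0 x)).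
have [t [t0 sgn]] : exists t : R, 0 < t /\ forall i,
    (0 < acoord x i -> 0 < acoord (x + t *: h) i) /\
    (0 < ccoord x i -> 0 < ccoord (x + t *: h) i).
  apply: (@filter_ex _ (0 : R)^'+); apply: filterI near_xth.
  exact: nbhs_right_gt.
set y := x + t *: h in sgn.
have [xE ax0 cx0 acx] := compl_decomp_coord x.
have [yE ay0 cy0 acy] := compl_decomp_coord y.
exists (fun i => t^-1 * (acoord y i - acoord x i)),
       (fun i => t^-1 * (ccoord y i - ccoord x i)); split.
  under eq_bigr do rewrite -scalerA scalerBl.
  under [X in _ = _ + X]eq_bigr do rewrite -scalerA scalerBl.
  rewrite -!scaler_sumr !sumrB -scalerDr addrACA -opprD -yE -xE.
  by rewrite /y addrAC subrr add0r scalerA mulVf ?gt_eqF // scale1r.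
move=> i; have [sa sc] := sgn i.
have tV0 : 0 <= t^-1 by rewrite invr_ge0 ltW.
have := acx i; have := acy i; have := ax0 i; have := cx0 i.
move: (ay0 i) (cy0 i) sa sc.
move: (acoord x i) (ccoord x i) (acoord y i) (ccoord y i) => ax cx ay cy.
move=> ay_ge0 cy_ge0 sa sc cx_ge0 ax_ge0 /eqP; rewrite mulf_eq0.
have axP : ax = 0 \/ 0 < ax.
  by move: ax_ge0; rewrite le_eqVlt => /predU1P[<-|]; [left | right].
have cxP : cx = 0 \/ 0 < cx.
  by move: cx_ge0; rewrite le_eqVlt => /predU1P[<-|]; [left | right].
move=> /orP acy0 /eqP; rewrite mulf_eq0 => /orP acx0.
split.
- by move=> ->; rewrite subr0 mulr_ge0.
- by move=> ->; rewrite subr0 mulr_ge0.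
(* A coordinate positive at [x] is positive at [y] too, so its partner vanishes at both points and
   has zero quotient. *)
- case: axP => [->|axp]; first by rewrite mul0r.
  case: acy0 => /eqP; first by move: (sa axp) => /gt_eqF /eqP.
  case: acx0 => /eqP; first by move: axp => /gt_eqF /eqP.
  by move=> -> ->; rewrite subrr !mulr0.
- case: cxP => [->|cxp]; first by rewrite mulr0.
  case: acy0 => /eqP; last by move: (sc cxp) => /gt_eqF /eqP.
  case: acx0 => /eqP; last by move: cxp => /gt_eqF /eqP.
  by move=> -> ->; rewrite subrr !(mulr0, mul0r).
- case: axP => [->|axp]; last first.
    case: acy0 => /eqP; first by move: (sa axp) => /gt_eqF /eqP.
    case: acx0 => /eqP; first by move: axp => /gt_eqF /eqP.
    by move=> -> ->; rewrite subrr !mulr0.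
  case: cxP => [->|cxp].
    (* With both coordinates zero at [x], complementarity at [y] decides. *)
    by case: acy0 => /eqP ->; rewrite !subr0 !(mulr0, mul0r).
  case: acy0 => /eqP; last by move: (sc cxp) => /gt_eqF /eqP.
  by move=> ->; rewrite subrr !(mulr0, mul0r).
Qed.

Lemma tangent_dir_derive x h a c : tangent_decomp x h a c ->
  dir_derive (metric_proj (cone b)) x h = \sum_i a i *: b i.
Proof. by move=> /tangent_dir_quot; exact: norm_lim_near_cst. Qed.

Lemma metric_proj_dir_derivable x h : dir_derivable (metric_proj (cone b)) x h.
Proof.
have [a [c /tangent_dir_quot quot]] := tangent_existence x h.
exact: is_cvg_near_cst quot.
Qed.

(** Where [acoord x i = 0], a positive [a i] forces [ccoord x i = 0], so [i] lies in [Ibullet];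
    symmetrically for [c i]. All other coefficients outside [Iplus], respectively [Iminus],
    vanish. *)
Lemma tangent_dir_decomp x h a c : tangent_decomp x h a c ->
  dir_decomp b u x h [set i in Ibullet b u x | 0 < a i]%SET
                     [set i in Ibullet b u x | 0 < c i]%SET.
Proof.
move=> [hE tan]; have [_ ax0 cx0 _] := compl_decomp_coord x.
split.
- by apply/fintype.subsetP => i; rewrite inE => /andP[].
- by apply/fintype.subsetP => i; rewrite inE => /andP[].
- apply/pred0P => i /=; rewrite !inE; apply/negP.
  move=> /andP[/andP[_ ai] /andP[_ ci]]; have [_ _ _ _ /eqP] := tan i.
  by rewrite mulf_eq0 !gt_eqF.
exists a, c; split=> [|i|i]; last 2 first.
- by rewrite inE => /andP[].
- by rewrite inE => /andP[].
rewrite hE -addrA; congr (_ + _);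
  rewrite [X in _ = X + _]big_mkcond [X in _ = _ + X]big_mkcond -big_split /=;
  apply: eq_bigr => i _; have [ai ci ac ca _] := tan i;
  rewrite ?in_Iplus ?in_Iminus finset.in_set in_Ibullet.
- case: (eqVneq (acoord x i) 0) => [a0|an0]; last first.
    by rewrite lt_neqAle eq_sym an0 ax0 addr0.
  rewrite a0 ltxx add0r; case: (ltP 0 (a i)); rewrite ?andbT ?andbF => ai0.
    by move/eqP: ca; rewrite mulf_eq0 gt_eqF //= => ->.
  by rewrite (_ : a i = 0) ?scale0r //; apply/le_anti; rewrite ai0 ai.
- case: (eqVneq (ccoord x i) 0) => [c0|cn0]; last first.
    have -> : 0 < ccoord x i by rewrite lt_neqAle eq_sym cn0 cx0.
    by rewrite andbF add0r.
  rewrite c0 ltxx addr0; case: (ltP 0 (c i)); rewrite ?andbT ?andbF => ci0.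
    by move/eqP: ac; rewrite mulf_eq0 [c i == 0]gt_eqF // orbF => ->.
  by rewrite (_ : c i = 0) ?scale0r //; apply/le_anti; rewrite ci0 ci.
Qed.

(** The coefficients are extended by zero off [Iplus] and [A], respectively off [B] and [Iminus].
    This covers any admissible [A] and [B], and the support conditions are those of
    [range_projE]. *)
Lemma dir_decomp_tangent x h (A B : {set 'I_n}) : dir_decomp b u x h A B ->
  exists a c, [/\ tangent_decomp x h a c,
    forall i, i \notin (Iplus b u x :|: A)%SET -> a i = 0
  & forall i, i \in (Iplus b u x :|: A)%SET -> c i = 0].
Proof.
move=> [/fintype.subsetP sA /fintype.subsetP sB dAB [al [be [hE al0 be0]]]].
have [xE ax0 cx0 acx] := compl_decomp_coord x.
have bulA i : i \in A -> acoord x i = 0 /\ ccoord x i = 0.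
  by move=> /sA; rewrite in_Ibullet => /andP[/eqP -> /eqP ->].
have bulB i : i \in B -> acoord x i = 0 /\ ccoord x i = 0.
  by move=> /sB; rewrite in_Ibullet => /andP[/eqP -> /eqP ->].
have AB0 i : i \in A -> i \in B -> False.
  by move=> iA iB; move/pred0P/(_ i): dAB; rewrite /= iA iB.
have pm i : 0 < acoord x i -> 0 < ccoord x i -> False.
  by move=> ai ci; have /eqP := acx i; rewrite mulf_eq0 !gt_eqF.
exists (fun i => if i \in (Iplus b u x :|: A)%SET then al i else 0).
exists (fun i => if i \in (B :|: Iminus b u x)%SET then be i else 0).
split; last 2 first.
- by move=> i /negbTE ->.
- move=> i iA; case: ifPn => //; move: iA.
  rewrite !finset.in_setU in_Iplus in_Iminus.
  move=> /orP[ai|iA] /orP[iB|ci].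
  + by move: ai; rewrite (bulB i iB).1 ltxx.
  + by case: (pm i).
  + by case: (AB0 i).
  + by move: ci; rewrite (bulA i iA).2 ltxx.
split.
  rewrite hE -addrA; congr (_ + _);
    rewrite [X in X + _]big_mkcond [X in _ + X]big_mkcond -big_split /=;
    apply: eq_bigr => i _; rewrite finset.in_setU ?in_Iplus ?in_Iminus.
  - case: (boolP (i \in A)) => [iA|_]; last first.
      by rewrite orbF; case: ifP; rewrite ?scale0r ?addr0.
    by rewrite (bulA i iA).1 ltxx add0r.
  - case: (boolP (i \in B)) => [iB|_] /=; last first.
      by case: ifP; rewrite ?scale0r ?add0r.
    by rewrite (bulB i iB).2 ltxx addr0.
move=> i; rewrite !finset.in_setU in_Iplus in_Iminus.
case: (boolP (i \in A)) => [iA|niA].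
  have [a0 c0] := bulA i iA; rewrite a0 c0 ltxx orbT orbF.
  case: (boolP (i \in B)) => [/(AB0 i iA)//|_].
  by rewrite !(mulr0, mul0r); split=> // _; exact/ltW/al0.
case: (boolP (i \in B)) => [iB|niB].
  have [a0 c0] := bulB i iB; rewrite a0 c0 ltxx.
  by rewrite !(mulr0, mul0r); split=> // _; exact/ltW/be0.
rewrite orbF /=; case: (ltP 0 (acoord x i)) => [ai|]; last first.
  move=> ai; have -> : acoord x i = 0 by apply/le_anti; rewrite ai ax0.
  by rewrite !mul0r; split=> // ->; rewrite ltxx.
case: (ltP 0 (ccoord x i)) => [/(pm i ai)//|ci].
have -> : ccoord x i = 0 by apply/le_anti; rewrite ci cx0.
by rewrite !mulr0; split=> // a0; move: ai; rewrite a0 ltxx.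
Qed.

(** * Failure of differentiability when [Ibullet] is nonempty *)

Lemma metric_proj_not_differentiable x k : k \in Ibullet b u x ->
  ~ differentiable (metric_proj (cone b)) x.
Proof.
rewrite in_Ibullet => /andP[/eqP ak /eqP ck] df.
have bkE : b k = \sum_i (i == k)%:R *: b i.
  rewrite (bigD1 k) //= eqxx scale1r big1 ?addr0 // => i /negbTE ->.
  by rewrite scale0r.
have tan_bk : tangent_decomp x (b k) (fun i => (i == k)%:R) (fun=> 0).
  split.
    by rewrite [X in _ + X]big1 ?addr0 // => i _; rewrite scale0r.
  move=> i; split; rewrite ?mulr0 //.
  by case: eqP => [->|]; rewrite ?ck ?mulr0 ?mul0r.
have [a [c tanN]] := tangent_existence x (- b k).
have [_ /(_ k) [/(_ ak) + _ _ _ _]] := tanN.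
have := differentiable_dir_derive (- b k) df.
(* Linearity would make the derivative along [- b k] equal to [- b k]; pairing with [u k] then
   yields [a k = -1], against [0 <= a k]. *)
rewrite linearN /= -differentiable_dir_derive // (tangent_dir_derive tanN).
rewrite (tangent_dir_derive tan_bk) -bkE => /(congr1 (dotv (u k))).
rewrite (dotv_assoc_sum u_assoc) dotvNr u_assoc eqxx opprK => /eqP.
by rewrite eqr_oppLR => /eqP ->; rewrite oppr_ge0 ler10.
Qed.

End SimplicialCone.

Theorem theorem3p5 (R : realType) (n : nat) (n_gt0 : (0 < n)%N)
    (b u : 'I_n -> 'cV[R]_n)
    (b_free : free [tuple b i | i < n])
    (u_assoc : assoc_vectors b u)
    (K_isotone : isotone_proj (cone b))
    (x : 'cV[R]_n) :
  (Ibullet b u x = finset.set0 ->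
     exists L : {linear 'cV[R]_n -> 'cV[R]_n},
       is_strict_diff (metric_proj (cone b)) x L /\
       forall y, L y = range_proj (colsmx b (Iplus b u x)) y)
  /\
  (Ibullet b u x <> finset.set0 ->
     [/\ ~ differentiable (metric_proj (cone b)) x,
         forall h, dir_derivable (metric_proj (cone b)) x h
       & forall h,
           (exists A B : {set 'I_n}, dir_decomp b u x h A B) /\
           (forall A B : {set 'I_n}, dir_decomp b u x h A B ->
              dir_derive (metric_proj (cone b)) x h =
              range_proj (colsmx b (Iplus b u x :|: A)%SET) h)]).
Proof.
split; first exact: metric_proj_strict_diff.
move=> /eqP/set0Pn [k kx]; split.
- exact: (metric_proj_not_differentiable u_assoc kx).
- exact: metric_proj_dir_derivable.
move=> h; split=> [|A B /(dir_decomp_tangent u_assoc) [a [c [tan a0 c0]]]].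
  have [a [c tan]] := tangent_existence u_assoc x h.
  by eexists; eexists; exact: (tangent_dir_decomp u_assoc tan).
(* Only the argument [h] is expanded, so that [range_projE] picks out its [b] part. *)
by rewrite (tangent_dir_derive u_assoc tan) {1}(proj1 tan) (range_projE u_assoc).
Qed.
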